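(* Let $n\ge 1$ and let $Q_n$ be the $n$-dimensional hypercube graph. The minimal variation of probability measures for $Q_n$ at scale $S\ge 0$ ($S$ an integer) is $$\varepsilon_{S,Q_n}=\frac{2\binom{n-1}{S}}{\sum_{k=0}^{S}\binom{n}{k}}.$$
   Context: $Q_n$ is the graph with vertex set $V=\{0,1\}^n$ in which two vertices are joined by an edge iff they differ in exactly one coordinate; each edge is given one orientation (from the vertex of smaller norm to the one of larger norm). The path-length metric on $Q_n$ ignores orientation and is the Hamming distance $d(u,v)=|\{i:u_i\ne v_i\}|$; $B(i,S)$ is the closed ball of radius $S$ about $i$. For a graph $G=(V,E)$, the minimal variation of probability measures $\varepsilon_{S,G}$ at scale $S$ is the minimal $\varepsilon\ge0$ for which there is a family of functions $\{\xi_i\colon V\to\mathbb{R}\}_{i\in V}$ with $\xi_i\ge 0$, $\|\xi_i\|_1=1$ and $\{j\in V:\xi_i(j)>0\}\subset B(i,S)$ for each $i\in V$, and $\|\xi_i-\xi_j\|_1\le\varepsilon$ for each $ij\in E$. *)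

(* Defs.v *)
From HB Require Import structures.
From mathcomp Require Import all_boot all_order all_algebra.
From mathcomp Require Import boolp classical_sets reals.
Set Implicit Arguments.
Unset Strict Implicit.
Unset Printing Implicit Defensive.
Import Order.TTheory GRing.Theory Num.Theory.
Local Open Scope classical_set_scope.
Local Open Scope ring_scope.

(* A finite oriented graph on [V] is given by its arc relation [E]. *)
Definition adj (V : finType) (E : rel V) : rel V :=
  [rel i j | E i j || E j i].

(* The path-length distance from [i] to [j] is at most [S] iff some walk with
   at most [S] edges, traversed in either direction, leads from [i] to [j]. *)
Definition gball (V : finType) (E : rel V) (i : V) (S : nat) : set V :=
  [set j | exists p : seq V,
     [/\ path (adj E) i p, last i p = j & (size p <= S)%N]].

Definition l1norm (R : realType) (V : finType) (f : V -> R) : R :=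
  \sum_(j : V) `|f j|.

Definition variation_bounds (R : realType) (V : finType) (E : rel V)
    (S : nat) : set R :=
  [set eps | 0 <= eps /\
     exists xi : V -> V -> R,
       [/\ forall i j, 0 <= xi i j,
           forall i, l1norm (xi i) = 1,
           forall i, [set j | 0 < xi i j] `<=` gball E i S
         & forall i j, E i j -> l1norm (fun k => xi i k - xi j k) <= eps]].

(* "epsilon_{S,G} = eps": the minimum exists (it is attained) and equals
   [eps]. *)
Definition is_min_variation (R : realType) (V : finType) (E : rel V)
    (S : nat) (eps : R) : Prop :=
  variation_bounds E S eps /\ lbound (variation_bounds E S) eps.

Notation cube n := {ffun 'I_n -> bool}.

Definition cube_norm (n : nat) (u : cube n) : nat := \sum_(i < n) u i.

Definition cube_arc (n : nat) : rel (cube n) :=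
  [rel u v : cube n | (#|[pred i | u i != v i]| == 1)%N &&
             (cube_norm u < cube_norm v)%N].

(* Main.v *)
Require Import Defs.
From mathcomp Require Import all_boot all_order all_algebra.
From mathcomp Require Import boolp classical_sets reals.
From mathcomp Require Import ring zify.
Import Order.TTheory GRing.Theory Num.Theory.
Local Open Scope ring_scope.

(** The value is attained by the uniform measures on the balls of radius [S]:
    the balls about two neighbours differ exactly in the two half-spheres of
    radius [S], each taken inside the facet of its own centre, and each of
    these has ['C(n.-1, S)] points.

    The lower bound is a flow (linear programming duality) argument.  Fix a
    target [j], write [N m] for the size of a ball of radius [m], and let a flow
    run along the edges that lead away from [j], with the value
    [c m = N m / 'C(n.-1, m)] on every edge from distance [m] to distance [m.+1].
    Two facts make this the right choice:
    - below distance [n], the net flow out of every vertex is the constant [n]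
      ([flow_value_divergence]);
    - [c] is nondecreasing in [m] ([flow_value_le]), so on the edges that meet
      the ball of radius [S] the flow is at most [c S].
    Pairing the flow with the gradient of [f i = xi i j], which is supported in
    the ball of radius [S] about [j], and summing by parts gives
    [2 * n * \sum_i f i <= c S * \sum_(l, i) `|f i - f (flip l i)|]
    ([ball_l1_gradient_bound]).  Now sum over all targets [j].  Every [xi i] has
    mass 1, and every one of the [n * 2 ^ n] ordered edges contributes at most
    [eps], so [2 * n * 2 ^ n <= c S * n * 2 ^ n * eps], which is [2 / c S <= eps].
    Averaging over [j] replaces any symmetrization of the family [xi].  When
    [n <= S] the claimed value is 0 and there is nothing to prove. *)

(** * Hamming distance and coordinate flips *)

Definition flip {n : nat} (l : 'I_n) (u : cube n) : cube n :=
  [ffun k => (k == l) (+) u k].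

Definition diffset {n : nat} (u v : cube n) : {set 'I_n} :=
  [set l | u l != v l].

Definition dist {n : nat} (u v : cube n) : nat := #|diffset u v|.

Lemma dist_le {n : nat} (u v : cube n) : (dist u v <= n)%N.
Proof. by rewrite -[leqRHS]card_ord max_card. Qed.

Lemma distxx {n : nat} (u : cube n) : dist u u = 0%N.
Proof. by apply: eq_card0 => l; rewrite !inE eqxx. Qed.

Lemma dist_eq0 {n : nat} (u v : cube n) : dist u v = 0%N -> u = v.
Proof.
move/eqP; rewrite cards_eq0 => /eqP/setP D0; apply/ffunP => l.
by move: (D0 l); rewrite !inE => /negbFE/eqP.
Qed.

Lemma flipK {n : nat} (l : 'I_n) : involutive (flip l).
Proof. by move=> u; apply/ffunP => k; rewrite !ffunE addKb. Qed.

Lemma flip_at {n : nat} (l : 'I_n) (u : cube n) : flip l u l = ~~ u l.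
Proof. by rewrite ffunE eqxx. Qed.

Lemma diffset_flipC {n : nat} (l : 'I_n) (u v : cube n) :
  diffset u (flip l v) = diffset (flip l u) v.
Proof.
by apply/setP => k; rewrite !inE !ffunE; case: (k == l) (u k) (v k) => [] [] [].
Qed.

Lemma dist_flip {n : nat} (l : 'I_n) (u v : cube n) :
  u l = v l -> dist (flip l u) v = (dist u v).+1.
Proof.
move=> uv; have -> : (dist u v).+1 = #|l |: diffset u v|.
  by rewrite cardsU1 inE uv eqxx.
congr #|pred_of_set _|; apply/setP => k; rewrite !inE ffunE.
by case: (eqVneq k l) => [->|_] //=; rewrite uv; case: (v l).
Qed.

Lemma dist_flip_le {n : nat} (l : 'I_n) (u v : cube n) :
  (dist u v <= (dist (flip l u) v).+1)%N.
Proof.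
case: (eqVneq (u l) (v l)) => [uv|uv]; first by rewrite (dist_flip _ _ _ uv); lia.
rewrite -{1}[u](flipK l) dist_flip // flip_at.
by case: (u l) (v l) uv => [] [].
Qed.

Lemma arc_flip {n : nat} (u v : cube n) :
  cube_arc u v -> exists l, v = flip l u.
Proof.
case/andP; rewrite -cardsE => /cards1P[l Hl] _.
exists l; apply/ffunP => k; rewrite ffunE; move/setP/(_ k): Hl; rewrite !inE.
by case: (k == l) (u k) (v k) => [] [] [].
Qed.

Lemma norm_flip {n : nat} (l : 'I_n) (u : cube n) :
  ~~ u l -> cube_norm (flip l u) = (cube_norm u).+1.
Proof.
move=> ul; rewrite /cube_norm (bigD1 l) //= [in RHS](bigD1 l) //= flip_at ul.
rewrite (negbTE ul) add0n add1n; congr _.+1.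
by apply: eq_bigr => k /negbTE kl; rewrite ffunE kl.
Qed.

Lemma adj_flip {n : nat} (l : 'I_n) (u : cube n) :
  adj (@cube_arc n) u (flip l u).
Proof.
have C (w : cube n) : #|[pred i | w i != flip l w i]| = 1%N.
  rewrite -(cards1 l) -[LHS]cardsE; congr #|pred_of_set _|; apply/setP => k.
  by rewrite !inE ffunE; case: (k == l) (w k) => [] [].
case: (boolP (u l)) => ul /=; apply/orP; [right|left]; apply/andP; split.
- by rewrite -{2}[u](flipK l) C.
- by rewrite -{2}[u](flipK l) (norm_flip l (flip l u)) // flip_at negbK.
- by rewrite C.
- by rewrite norm_flip.
Qed.

(** A walk changes one coordinate per step, so it cannot beat the Hamming
    distance; flipping the differing coordinates one by one attains it. *)
Lemma cube_gballP {n : nat} (u v : cube n) (S : nat) :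
  gball (@cube_arc n) u S v <-> (dist u v <= S)%N.
Proof.
split=> [[p []]|].
  elim: p u S => [|w p IH] u S /= => [_ -> _|/andP[uw pw] lw].
    by rewrite distxx.
  case: S => // S pS; have {}IH := IH w S pw lw pS.
  have [l wl] : exists l, w = flip l u.
    case/orP: uw => /arc_flip[l e]; first by exists l.
    by exists l; rewrite e flipK.
  by rewrite wl in IH; apply: leq_trans (dist_flip_le l u v) _.
elim: S u => [|S IH] u.
  by rewrite leqn0 => /eqP/dist_eq0 ->; exists [::].
case: (set_0Vmem (diffset u v)) => [D0 _|[l]].
  by exists [::]; split=> //=; apply: dist_eq0; rewrite /dist D0 cards0.
rewrite inE => uv; rewrite -{1}[u](flipK l) dist_flip; last first.
  by rewrite flip_at; case: (u l) (v l) uv => [] [].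
rewrite ltnS => /IH[p [pp pl ps]].
by exists (flip l u :: p); split=> //=; rewrite ?pp ?andbT //; apply: adj_flip.
Qed.

(** * Sizes of spheres and balls *)

(** The map [diffset u] is a bijection from vertices to sets of coordinates,
    so counts of vertices around [u] become counts of subsets. *)
Lemma card_diffset {n : nat} (u : cube n) (P : pred {set 'I_n}) :
  #|[pred v | P (diffset u v)]| = #|[set A | P A]|.
Proof.
have B : bijective (diffset u).
  exists (fun A : {set 'I_n} => [ffun l => (l \in A) (+) u l]) => [v|A].
    by apply/ffunP => l; rewrite ffunE inE; case: (u l) (v l) => [] [].
  by apply/setP => l; rewrite inE ffunE; case: (u l) (l \in A) => [] [].
rewrite -(on_card_preimset (onW_bij _ B)) cardsE.
by apply: eq_card => v; rewrite !inE [RHS]inE.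
Qed.

Lemma card_sphere {n : nat} (u : cube n) (k : nat) :
  #|[pred v | dist u v == k]| = 'C(n, k).
Proof. by rewrite (card_diffset u (fun A => #|A| == k)) card_draws card_ord. Qed.

(** Keeping the coordinate [l] of [u] means choosing the [k] changed
    coordinates among the other [n.-1]. *)
Lemma card_half_sphere {n : nat} (l : 'I_n) (u : cube n) (k : nat) :
  #|[pred v : cube n | (u l == v l) && (dist u v == k)]| = 'C(n.-1, k).
Proof.
rewrite -[X in 'C(X.-1, _)]card_ord -(cardsC1 l) -cards_draws.
pose P (A : {set 'I_n}) := (A \subset [set~ l]) && (#|A| == k).
rewrite -(card_diffset u P) /P.
apply: eq_card => v; rewrite !inE; congr andb.
by rewrite finset.subsetC finset.sub1set !inE negbK.
Qed.

Definition ball_size (n m : nat) : nat := (\sum_(0 <= k < m.+1) 'C(n, k))%N.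

Lemma ball_sizeS (n m : nat) :
  ball_size n m.+1 = (ball_size n m + 'C(n, m.+1))%N.
Proof. by rewrite /ball_size big_nat_recr. Qed.

Lemma ball_size_gt0 (n m : nat) : (0 < ball_size n m)%N.
Proof. by rewrite /ball_size big_nat_recl // bin0. Qed.

Lemma card_ball {n : nat} (u : cube n) (S : nat) :
  #|[pred v | (dist u v <= S)%N]| = ball_size n S.
Proof.
elim: S => [|S IH].
  rewrite /ball_size big_nat1 -(card_sphere u).
  by apply: eq_card => v; rewrite !inE leqn0.
rewrite ball_sizeS -IH -(card_sphere u) -cardUI [X in (_ + X)%N]eq_card0.
  by rewrite addn0; apply: eq_card => v; rewrite !inE leq_eqVlt orbC.
by move=> v; rewrite !inE; apply/andP => -[h /eqP e]; rewrite e ltnn in h.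
Qed.

(** * Variation of the uniform measures on balls *)

(** The flip of [l] exchanges the two facets of the cube in direction [l].  The
    facet is named by a vertex [v] because in each use it is the one where the
    distance to [v] grows when [l] is flipped. *)
Lemma sum_flip_invariant {R : realDomainType} {n : nat} (l : 'I_n) (v : cube n)
    (F : cube n -> R) :
  (forall u, F (flip l u) = F u) ->
  \sum_u F u = 2 * \sum_(u : cube n | v l == u l) F u.
Proof.
move=> FE; rewrite (bigID (fun u : cube n => v l == u l)) /= mulr2n mulrDl mul1r.
congr (_ + _); rewrite [RHS](reindex_inj (inv_inj (flipK l))) /=.
by apply: eq_big => [u|u _]; rewrite ?FE // flip_at; case: (u l) (v l) => [] [].
Qed.

Lemma sum_ball {R : realFieldType} {n : nat} (u : cube n) (S : nat) :
  \sum_v (dist u v <= S)%:R = (ball_size n S)%:R :> R.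
Proof.
rewrite -(card_ball u) -sumr_const [RHS]big_mkcond /=.
by apply: eq_bigr => v _; rewrite inE; case: ifP.
Qed.

(** On the facet of [u] the distance to [flip l u] is one more than that to [u],
    so the two indicators differ exactly at distance [S] from [u]. *)
Lemma sum_ball_flip {R : realFieldType} {n : nat} (l : 'I_n)
    (u : cube n) (S : nat) :
  \sum_v `|(dist u v <= S)%:R - (dist (flip l u) v <= S)%:R| =
    2 * 'C(n.-1, S)%:R :> R.
Proof.
rewrite (sum_flip_invariant l u) => [|v]; last first.
  by rewrite /dist !diffset_flipC flipK distrC.
congr (_ * _); rewrite -(card_half_sphere l u) -sumr_const.
rewrite big_mkcond [RHS]big_mkcond; apply: eq_bigr => v _; rewrite !inE.
case: eqP => //= uv; rewrite dist_flip //.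
by case: ltngtP => //; rewrite ?subrr ?normr0 // subr0 normr1.
Qed.

(** * The flow away from a vertex *)

(** Counting the edges between consecutive spheres gives
    [k.+1 * 'C(n, k.+1) = (n - k) * 'C(n, k)]; bounding [k] by [m] on both sides
    and summing over the spheres of the ball compares the two balls. *)
Lemma ball_size_growth (n m : nat) :
  ((n - m) * ball_size n m <= m.+1 * ball_size n m.+1)%N.
Proof.
rewrite /ball_size [in leqRHS]big_nat_recl // mulnDr !big_distrr /=.
apply: leq_trans (leq_addl _ _); rewrite big_nat_cond [leqRHS]big_nat_cond.
apply: leq_sum => k /andP[/andP[_ km] _].
apply: (@leq_trans ((n - k) * 'C(n, k))%N).
  by rewrite leq_mul2r leq_sub2l ?orbT.
by rewrite -mul_bin_left leq_mul2r km orbT.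
Qed.

(** The value on an edge from distance [m] to distance [m.+1] in the cube of
    dimension [n.+1], so the denominator is a binomial coefficient of the
    predecessor [n] of the dimension. *)
Definition flow_value {R : realFieldType} (n m : nat) : R :=
  (ball_size n.+1 m)%:R / 'C(n, m)%:R.

Lemma flow_value_ge0 {R : realFieldType} (n m : nat) : 0 <= flow_value n m :> R.
Proof. by rewrite divr_ge0 ?ler0n. Qed.

(** The binomial coefficient ['C(n, m)] is multiplied by [(n - m) / m.+1] when [m]
    increases, and the size of the ball by at least [(n.+1 - m) / m.+1]. *)
Lemma flow_value_le {R : realFieldType} (n m S : nat) :
  (m <= S)%N -> (S <= n)%N -> flow_value n m <= flow_value n S :> R.
Proof.
elim: S => [|S IH] mS Sn; first by move: mS; rewrite leqn0 => /eqP ->.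
move: mS; rewrite leq_eqVlt => /predU1P[->//|mS].
apply: le_trans (IH mS (ltnW Sn)) _.
rewrite /flow_value ler_pdivrMr ?ltr0n ?bin_gt0 1?ltnW // mulrAC.
rewrite ler_pdivlMr ?ltr0n ?bin_gt0 // -!natrM ler_nat.
rewrite -(leq_pmul2l (ltn0Sn S)) mulnCA mul_bin_left mulnA.
rewrite [leqRHS]mulnA leq_mul2r; apply/orP; right.
apply: leq_trans (ball_size_growth n.+1 S).
by rewrite mulnC leq_mul2r leq_sub2r ?orbT.
Qed.

(** A vertex at distance [m] has [n.+1 - m] edges leading away and [m] edges
    coming in.  For [m > 0], over the common denominator ['C(n, m.-1)] the two terms are
    [m] times consecutive ball sizes, so their difference leaves a single
    sphere, and [m * 'C(n.+1, m) = n.+1 * 'C(n, m.-1)].  At [m = n.+1] the identity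
    fails, because no outgoing edge is left. *)
Lemma flow_value_divergence {R : realFieldType} (n m : nat) : (m <= n)%N ->
  (n.+1 - m)%:R * flow_value n m - m%:R * flow_value n m.-1 = n.+1%:R :> R.
Proof.
case: m => [|m] mn.
  by rewrite subn0 mul0r subr0 /flow_value /ball_size big_nat1 !bin0 divr1 mulr1.
have C0 : 'C(n, m)%:R != 0 :> R by rewrite pnatr_eq0 -lt0n bin_gt0 ltnW.
have C1 : 'C(n, m.+1)%:R != 0 :> R by rewrite pnatr_eq0 -lt0n bin_gt0.
rewrite /flow_value subSS /=.
have -> : (n - m)%:R = m.+1%:R * 'C(n, m.+1)%:R / 'C(n, m)%:R :> R.
  by rewrite -natrM mul_bin_left natrM mulfK.
rewrite ball_sizeS natrD.
have E : n.+1%:R * 'C(n, m)%:R = m.+1%:R * 'C(n.+1, m.+1)%:R :> R.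
  by rewrite -!natrM -mul_bin_diag.
apply: (mulIf C0); rewrite E; field.
by rewrite C0 C1.
Qed.

(** Summation by parts: the left side pairs the flow with the gradient of [f]
    along the edges leading away from [j], namely those where [i] agrees with [j]
    in the flipped coordinate [l].  Collecting the terms in [f i] leaves the
    constant divergence of the flow.  The support of [f] keeps away the antipode
    of [j], which is the sink. *)
Lemma flow_against_gradient {R : realFieldType} {n : nat} (S : nat) (j : cube n.+1)
    (f : cube n.+1 -> R) :
  (S <= n)%N -> (forall i, (S < dist i j)%N -> f i = 0) ->
  \sum_l \sum_(i : cube n.+1 | j l == i l)
      flow_value n (dist i j) * (f i - f (flip l i)) =
    n.+1%:R * \sum_i f i.
Proof.
move=> Sn fS.
transitivity (\sum_l \sum_(i : cube n.+1)
    ((j l == i l)%:R * flow_value n (dist i j) * f i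
    - (j l != i l)%:R * flow_value n (dist i j).-1 * f i)).
  apply: eq_bigr => l _.
  under eq_bigr do rewrite mulrBr.
  rewrite !sumrB; congr (_ - _).
    by rewrite big_mkcond; apply: eq_bigr => i _; case: eqP; rewrite ?mul1r ?mul0r.
  (* The value of [f] at the head of an edge is charged to that head, which is
     one step farther from [j] than the tail; hence the predecessor. *)
  rewrite [RHS](reindex_inj (inv_inj (flipK l))) big_mkcond.
  apply: eq_bigr => i _; rewrite flip_at.
  case: eqP => [ji|/eqP ji]; last first.
    by move: ji; case: (j l) (i l) => [] [] //; rewrite !mul0r.
  by rewrite dist_flip // ji; case: (i l); rewrite mul1r.
rewrite exchange_big /= mulr_sumr; apply: eq_bigr => i _.
have [/fS ->|dS] := ltnP S (dist i j).
  by rewrite mulr0 big1 // => l _; rewrite !mulr0 subrr.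
rewrite sumrB -!mulr_suml -mulrBl.
rewrite -(flow_value_divergence n (dist i j)) ?(leq_trans dS) //.
(* The numbers of incoming and outgoing edges at [i]. *)
have D : \sum_l (j l != i l)%:R = (dist i j)%:R :> R.
  rewrite /dist -sum1_card natr_sum [RHS]big_mkcond; apply: eq_bigr => l _.
  by rewrite inE eq_sym; case: eqP.
have D' : \sum_l (j l == i l)%:R = (n.+1 - dist i j)%:R :> R.
  rewrite natrB ?dist_le // -D; apply: (canRL (addrK _)).
  rewrite -big_split /= (eq_bigr (fun=> 1)) ?sumr_const ?card_ord // => l _.
  by case: eqP; rewrite ?addr0 ?add0r.
by rewrite D D'.
Qed.

(** The factor 2 appears because the right side runs over ordered edges while
    the flow uses each edge in one direction. *)
Lemma ball_l1_gradient_bound {R : realFieldType} {n : nat} (S : nat) (j : cube n.+1)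
    (f : cube n.+1 -> R) :
  (S <= n)%N -> (forall i, (S < dist i j)%N -> f i = 0) ->
  2 * n.+1%:R * \sum_i f i <=
    flow_value n S * \sum_l \sum_i `|f i - f (flip l i)|.
Proof.
move=> Sn fS; rewrite -mulrA -(flow_against_gradient S j f Sn fS) !mulr_sumr.
apply: ler_sum => l _; rewrite (sum_flip_invariant l j) => [|i]; last first.
  by rewrite flipK distrC.
rewrite mulrCA ler_wpM2l // mulr_sumr; apply: ler_sum => i /eqP ji.
(* Outside the ball the gradient vanishes, so only the values
   [flow_value n m] with [m <= S] matter. *)
have [dS|dS] := leqP (dist i j) S.
  apply: le_trans (ler_wpM2l (flow_value_ge0 _ _) (ler_norm _)) _.
  by rewrite ler_wpM2r // flow_value_le.
by rewrite !fS ?subrr ?normr0 ?mulr0 // dist_flip // ltnS ltnW.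
Qed.

(** * The minimal variation *)

Theorem theorem8p1 (R : realType) (n : nat) (hn : (1 <= n)%N) (S : nat) :
  is_min_variation (@cube_arc n) S
    (2 * 'C(n.-1, S)%:R / (\sum_(0 <= k < S.+1) 'C(n, k)%:R) : R).
Proof.
have N0 : 0 < (ball_size n S)%:R :> R by rewrite ltr0n ball_size_gt0.
rewrite -natr_sum -/(ball_size n S); split.
  split; first by rewrite divr_ge0 ?mulr_ge0 ?ler0n.
  exists (fun i j => (dist i j <= S)%:R / (ball_size n S)%:R); split.
  - by move=> i j; rewrite divr_ge0 ?ler0n.
  - move=> i; rewrite /l1norm.
    under eq_bigr do rewrite ger0_norm ?divr_ge0 ?ler0n //.
    by rewrite -mulr_suml sum_ball divff // gt_eqF.
  - move=> i j /= ij; apply/cube_gballP; move: ij.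
    by case: leqP => //; rewrite mul0r ltxx.
  - move=> i j /arc_flip[l ->]; rewrite /l1norm.
    under eq_bigr do rewrite -mulrBl normrM [`|_^-1|]ger0_norm ?invr_ge0 ?ler0n //.
    by rewrite -mulr_suml sum_ball_flip.
move=> eps [eps0 [xi [xi0 xi1 xiS xiE]]].
case: n hn N0 xi xi0 xi1 xiS xiE => // n _ N0 xi xi0 xi1 xiS xiE.
have [Sn|Sn] := leqP S n; last by rewrite bin_small // mulr0 mul0r.
have xiB i j : (S < dist i j)%N -> xi i j = 0.
  move=> ij; apply/eqP; rewrite eq_le xi0 andbT leNgt; apply/negP => /xiS.
  by move/cube_gballP; rewrite leqNgt ij.
have edge i l : \sum_j `|xi i j - xi (flip l i) j| <= eps.
  case/orP: (adj_flip l i) => /xiE //; apply: le_trans.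
  by rewrite le_eqVlt; apply/predU1l/eq_bigr => j _; rewrite distrC.
set M : R := #|{: cube n.+1}|%:R.
have M0 : 0 < M by rewrite ltr0n; apply/card_gt0P; exists [ffun=> false].
have mass : \sum_j \sum_i xi i j = M.
  rewrite exchange_big /= /M -sum1_card natr_sum; apply: eq_bigr => i _.
  by rewrite -(xi1 i); apply: eq_bigr => j _; rewrite ger0_norm.
(* The gradient bound summed over all targets [j]. *)
have total : 2 * n.+1%:R * M <= flow_value n S * (n.+1%:R * (M * eps)).
  rewrite -mass mulr_sumr.
  have bound j := ball_l1_gradient_bound S j (xi^~ j) Sn (xiB^~ j).
  apply: le_trans (ler_sum _ (fun j _ => bound j)) _.
  rewrite -mulr_sumr ler_wpM2l ?flow_value_ge0 // mass exchange_big /=.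
  have -> : n.+1%:R * (M * eps) = \sum_(l < n.+1) \sum_(i : cube n.+1) eps.
    by rewrite !sumr_const card_ord [LHS]mulr_natl /M mulr_natl.
  by apply: ler_sum => l _; rewrite exchange_big /=; apply: ler_sum => i _.
have C0 : 0 < 'C(n, S)%:R :> R by rewrite ltr0n bin_gt0.
have n0 : 0 < n.+1%:R * M :> R by rewrite mulr_gt0 ?ltr0Sn.
rewrite ler_pdivrMr //= -(ler_pM2l n0) mulrCA mulrA mulrA.
apply: le_trans (ler_wpM2r (ltW C0) total) _.
rewrite le_eqVlt; apply/predU1l; rewrite /flow_value; field.
by rewrite gt_eqF.
Qed.
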